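(* Let $u_1 < u_2 < \cdots < u_n$ be a strictly increasing sequence of positive integers. Let $i_1 < \cdots < i_t$ be all the indices $i \in \{1,\dots,n-1\}$ for which $u_{i+1}-u_i > 1$, and write $g_j = u_{i_j+1}-u_{i_j} > 1$ for $1 \le j \le t$. Let $f\colon \mathbb{R}^+ \to \mathbb{R}$ be a strictly monotonic differentiable function. Then $$\sum_{i=1}^{n} f(u_i) = \sum_{i=u_1}^{u_n} f(i) - \sum_{j=1}^{t} GS_{i_j}^{(f)},$$ where $GS_{i_j}^{(f)} = \sum_{i=u_{i_j}+1}^{u_{i_j+1}-1} f(i)$ is the $f$-gap-sum of the $j$-th gap.
   Context: $\mathbb{R}^+$ denotes the positive reals. For an increasing sequence of positive integers $(u_i)$ and a strictly monotonic differentiable $f\colon\mathbb{R}^+\to\mathbb{R}$, the $f$-gap-sum at index $m$ is $GS_m^{(f)} = \sum_{i=u_m+1}^{u_{m+1}-1} f(i)$, the sum of $f$ over the integers strictly between $u_m$ and $u_{m+1}$. *)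

(* Defs.v *)
From mathcomp Require Import all_boot all_order all_algebra.
From mathcomp Require Import all_classical all_reals all_analysis.

Set Implicit Arguments.
Unset Strict Implicit.
Unset Printing Implicit Defensive.

Import Order.TTheory GRing.Theory Num.Theory.
Import numFieldNormedType.Exports.

Local Open Scope ring_scope.

(* A finite sequence u_1, ..., u_n is a function u : nat -> nat of which only
   the values at the indices 1, ..., n matter; likewise a function on the
   positive reals is a total function f : R -> R of which only the values at
   positive arguments matter. *)

Definition positive_increasing_seq (n : nat) (u : nat -> nat) : Prop :=
  (forall i : nat, (1 <= i <= n)%N -> (0 < u i)%N) /\
  (forall i j : nat, (1 <= i)%N -> (i < j)%N -> (j <= n)%N -> (u i < u j)%N).

(* The subtraction is truncated, which is harmless where u increases. *)
Definition gap (u : nat -> nat) (i : nat) : nat := (u i.+1 - u i)%N.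

(* k_1 < ... < k_t are exactly the i in {1, ..., n - 1} with
   u_{i+1} - u_i > 1. *)
Definition gap_indices (n : nat) (u : nat -> nat) (t : nat) (k : nat -> nat)
    : Prop :=
  (forall j l : nat, (1 <= j)%N -> (j < l)%N -> (l <= t)%N -> (k j < k l)%N) /\
  (forall i : nat,
     (exists j : nat, (1 <= j <= t)%N /\ k j = i) <->
     ((1 <= i < n)%N /\ (1 < gap u i)%N)).

Definition strictly_monotonic_pos (R : realType) (f : R -> R) : Prop :=
  (forall x y : R, 0 < x -> x < y -> f x < f y) \/
  (forall x y : R, 0 < x -> x < y -> f y < f x).

Definition differentiable_pos (R : realType) (f : R -> R) : Prop :=
  forall x : R, 0 < x -> derivable f x 1.

Definition gap_sum (R : realType) (f : R -> R) (u : nat -> nat) (m : nat) : R :=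
  \sum_((u m).+1 <= i < u m.+1) f i%:R.

(* Main.v *)
Require Import Defs.
From mathcomp Require Import all_boot all_order all_algebra.
From mathcomp Require Import all_classical all_reals all_analysis.

Import Order.TTheory GRing.Theory Num.Theory.
Import numFieldNormedType.Exports.

Local Open Scope ring_scope.

(** The integers of the interval [u 1, u n] are the values u 1, ..., u n
    together with the integers lying strictly between two consecutive values.
    Summing f over the interval therefore gives the sum over the values plus
    the sum over all consecutive pairs of the sum of f strictly between them
    ([sum_interval_split]). A consecutive pair at distance 1 has nothing
    strictly between its members, so only the pairs listed by the gap indices
    contribute, each exactly once ([sum_gap_indices]). *)

(** By induction on [n]: appending the value [u n.+1] extends the interval by
    the integers strictly between [u n] and [u n.+1], and then by [u n.+1]
    itself. *)
Lemma sum_interval_split (V : nmodType) (F : nat -> V) (u : nat -> nat)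
    (n : nat) :
  (0 < n)%N ->
  (forall i, (0 < i < n)%N -> (u i < u i.+1)%N) ->
  \sum_(u 1%N <= x < (u n).+1) F x =
  \sum_(1 <= i < n.+1) F (u i) +
  \sum_(1 <= i < n) \sum_((u i).+1 <= x < u i.+1) F x.
Proof.
elim: n => [//|[|n] IHn] _ u_incr.
  by rewrite !big_nat1 big_geq // addr0.
have u_incr' i : (0 < i < n.+1)%N -> (u i < u i.+1)%N.
  by case/andP=> i_gt0 lt_in; apply: u_incr; rewrite i_gt0 ltnW.
have u_step : (u n.+1 < u n.+2)%N by apply: u_incr; rewrite ltnSn.
have u1_le m : (m <= n.+1)%N -> (u 1%N <= u m.+1)%N.
  elim: m => // m IHm lt_mn; apply: leq_trans (IHm (ltnW lt_mn)) (ltnW _).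
  by apply: u_incr; rewrite ltnS.
rewrite big_nat_recr /=; last exact: u1_le.
rewrite (@big_cat_nat _ _ _ (u n.+1).+1) //=; last exact/leqW/u1_le.
rewrite IHn // [in RHS]big_nat_recr //= [X in _ = _ + X]big_nat_recr //=.
by rewrite -!addrA; congr (_ + _); rewrite addrA addrC.
Qed.

(** Strict monotonicity makes [k] injective on its range of indices, so
    reindexing along [k] counts each gap above 1 once, and the indices that
    [k] misses carry terms that vanish. *)
Lemma sum_gap_indices (V : nmodType) (G : nat -> V) (n : nat)
    (u : nat -> nat) (t : nat) (k : nat -> nat) :
  gap_indices n u t k ->
  (forall i, (0 < i < n)%N -> (gap u i <= 1)%N -> G i = 0) ->
  \sum_(1 <= j < t.+1) G (k j) = \sum_(1 <= i < n) G i.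
Proof.
case=> k_incr k_gaps G0.
rewrite [RHS](bigID (fun i => 1 < gap u i)%N) /=.
rewrite [X in _ = _ + X]big_nat_cond [X in _ = _ + X]big1 ?addr0; last first.
  by move=> i /andP[i_range]; rewrite -leqNgt; apply: G0.
rewrite -[RHS]big_filter -(big_map k predT G).
apply/perm_big/uniq_perm; last 1 first.
- move=> i; rewrite mem_filter mem_index_iota andbC.
  apply/mapP/andP.
    case=> j; rewrite mem_index_iota => j_range ->.
    by apply/k_gaps; exists j.
  by case/k_gaps=> j [j_range <-]; exists j; rewrite ?mem_index_iota.
- rewrite map_inj_in_uniq ?iota_uniq // => i j.
  rewrite !mem_index_iota !ltnS => /andP[i_gt0 le_it] /andP[j_gt0 le_jt] kij.
  case: (ltngtP i j) => // [lt_ij | lt_ji].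
  + by have := k_incr _ _ i_gt0 lt_ij le_jt; rewrite kij ltnn.
  + by have := k_incr _ _ j_gt0 lt_ji le_it; rewrite kij ltnn.
- by rewrite filter_uniq ?iota_uniq.
Qed.

Theorem theorem3p1 (R : realType) (n : nat) (u : nat -> nat)
    (t : nat) (k : nat -> nat) (f : R -> R)
    (hn : (1 <= n)%N)
    (hu : positive_increasing_seq n u)
    (hk : gap_indices n u t k)
    (hmono : strictly_monotonic_pos f)
    (hdiff : differentiable_pos f) :
  \sum_(1 <= i < n.+1) f (u i)%:R =
  \sum_(u 1%N <= i < (u n).+1) f i%:R - \sum_(1 <= j < t.+1) gap_sum f u (k j).
Proof.
have [_ u_incr] := hu.
rewrite (sum_gap_indices _ (gap_sum f u) n u t k hk); last first.
  move=> i _; rewrite /gap leq_subLR addn1 => u_next.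
  by rewrite /gap_sum big_geq.
rewrite (sum_interval_split _ (fun x => f x%:R)) //; first by rewrite addrK.
by move=> i /andP[i_gt0 lt_in]; apply: u_incr.
Qed.
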